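(* Let $f:(\mathbb{C}^2,0)\to(\mathbb{C},0)$ be a holomorphic function germ, mini-regular in $x$, and let $\mathcal{C}$ be a gradient canyon of $f$ of degree $d=d_{\mathcal{C}}>1$. Then $$\operatorname{mult}(\mathcal{C})=b_{\mathcal{C}}\cdot\operatorname{mult}^{\mathrm{bar}}(\mathcal{C}).$$
   Context: **Arcs.** $\mathbb{F}$ is the field of convergent fractional power series (Puiseux series) in $y$ over $\mathbb{C}$; $\operatorname{ord}$ is the order in $y$ ($\operatorname{ord}0=\infty$); $\mathbb{F}_1=\{\eta\in\mathbb{F}:\operatorname{ord}\eta\ge1\}$. For $\eta=\sum a_iy^{n_i/N}\in\mathbb{F}_1$ with $N$ minimal, $\eta_*$ denotes the curve germ that is the image of $t\mapsto(\eta(t^N),t^N)$; the $N$ conjugates of $\eta$ define the same $\eta_*$. A germ $f$ with $m=\operatorname{ord}_0f$ is mini-regular in $x$ if its initial form $f_m$ satisfies $f_m(1,0)\ne0$. A polar arc of $f$ is $\gamma\in\mathbb{F}_1$ with $f_x(\gamma(y),y)\equiv0$ and $f(\gamma(y),y)\not\equiv0$. **Canyons.** The gradient degree $d(\gamma)\in\mathbb{Q}$ of a polar arc $\gamma$ is the smallest $q$ such that $\operatorname{ord}\|\operatorname{grad}f(\gamma(y),y)\|=\operatorname{ord}\|\operatorname{grad}f(\gamma(y)+uy^q,y)\|$ for generic $u\in\mathbb{C}$. The gradient canyon $\mathcal{GC}(\gamma_* )$ is the set of curve germs $\alpha_*$ with $\alpha=\gamma+uy^{d(\gamma)}+\text{h.o.t.}$,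 $u\in\mathbb{C}$. All polar arcs in a canyon $\mathcal{C}$ have the same gradient degree $d_{\mathcal{C}}$, the degree of $\mathcal{C}$. **Multiplicities.** Write $f_x=v\prod_{i=1}^{m-1}(x-\gamma_i(y))$, $v$ a unit, $\gamma_i\in\mathbb{F}_1$ the Puiseux roots of $f_x$ listed with multiplicity (conjugates are distinct indices, repeated roots are repeated). Put $I(\mathcal{C})=\{i\in\{1,\dots,m-1\}\mid\gamma_{i,*}\in\mathcal{C}\}$. - Polar multiplicity: $\operatorname{mult}(\mathcal{C})=\#I(\mathcal{C})$. - Bar multiplicity: for a fixed Puiseux representative $\gamma$ (one of the $\gamma_i$, $i\in I(\mathcal{C})$), $\operatorname{mult}^{\mathrm{bar}}(\mathcal{C})=\#\{i\in I(\mathcal{C})\mid\operatorname{ord}(\gamma_i(y)-\gamma(y))\ge d\}$; this is independent of the choice of $\gamma$. - Number of trunks: $b_{\mathcal{C}}=\#(I(\mathcal{C})/\!\equiv_d)$, where $i\equiv_dj$ iff $\operatorname{ord}(\gamma_i-\gamma_j)\ge d$ (equivalently, iff $\gamma_i$ and $\gamma_j$ have the same terms of order strictly below $d$). *)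

(* Defs.v *)
From HB Require Import structures.
From mathcomp Require Import all_boot all_order all_algebra.
From mathcomp Require Import complex.
From mathcomp Require Import all_classical all_reals all_analysis.

Set Implicit Arguments.
Unset Strict Implicit.
Unset Printing Implicit Defensive.

Import Order.TTheory GRing.Theory Num.Theory.
Import numFieldNormedType.Exports.

Local Open Scope classical_set_scope.
Local Open Scope ring_scope.

(* The complex numbers over [R : realType]; [_^o] carries their norm and their
   topology, so that [differentiable] and ['D_v f] below are complex
   differentiability and complex directional derivatives. *)
Notation Cplx R := ((complex R)^o).

Section HolomorphicGerms.
Variable R : realType.
Local Notation C := (Cplx R).
Local Notation C2 := (Cplx R * Cplx R)%type.

(* Germs at the origin are represented by globally defined functions, of which
   only the values near [0] matter. *)
Definition holomorphic_germ (f : C2 -> C) : Prop :=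
  \forall p \near (0 : C2), differentiable f p.

Definition partial_x (f : C2 -> C) (p : C2) : C := 'D_((1, 0) : C2) f p.
Definition partial_y (f : C2 -> C) (p : C2) : C := 'D_((0, 1) : C2) f p.

Definition grad_norm (f : C2 -> C) (p : C2) : C :=
  sqrtC (`|partial_x f p| ^+ 2 + `|partial_y f p| ^+ 2).

(* The binary form \sum_(i <= m) c_i x^i y^(m-i). *)
Definition binary_form (m : nat) (c : 'I_m.+1 -> C) (p : C2) : C :=
  \sum_(i < m.+1) c i * p.1 ^+ i * p.2 ^+ (m - i).

(* [m] is the order of [f] at 0 and [c] gives the initial form f_m, i.e. the
   first nonzero homogeneous term of the Taylor expansion of [f] at 0. *)
Definition is_initial_form (f : C2 -> C) (m : nat) (c : 'I_m.+1 -> C) : Prop :=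
  (exists i, c i != 0) /\
  (fun p : C2 => (f p - binary_form c p) / `|p| ^+ m : C) @ (0 : C2)^' --> (0 : C).

Definition mini_regular_x (f : C2 -> C) (m : nat) : Prop :=
  exists2 c : 'I_m.+1 -> C, is_initial_form f c & binary_form c (1, 0) != 0.

End HolomorphicGerms.

Section Arcs.
Variable R : realType.
Local Notation C := (Cplx R).
Local Notation C2 := (Cplx R * Cplx R)%type.

(* A fractional power series \sum_q a_q y^q is given by its coefficients
   [a : rat -> C]. *)
Definition common_denominator (a : rat -> C) (N : nat) : Prop :=
  (0 < N)%N /\ forall q : rat, a q != 0 -> q * N%:R \is a Num.int.

Definition t_series (a : rat -> C) (N : nat) (t : C) : nat -> C :=
  fun n => a (n%:R / N%:R) * t ^+ n.

(* The field of convergent Puiseux series: the exponents have a common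
   denominator, the principal part is finite, and the remaining part converges
   in a neighbourhood of 0. *)
Definition puiseux : set (rat -> C) :=
  [set a | exists N : nat,
     [/\ common_denominator a N,
         exists q0 : rat, forall q, q < q0 -> a q = 0 &
         exists2 r : C, 0 < r &
           forall t : C, `|t| < r -> cvgn (series (t_series a N t))]].

Definition ord (a : rat -> C) : \bar rat :=
  xget +oo%E [set q%:E | q in
    [set q : rat | a q != 0 /\ forall p : rat, p < q -> a p = 0]].

Definition puiseux1 : set (rat -> C) :=
  [set a | puiseux a /\ (1%:E <= ord a)%E].

(* The series u y^q. *)
Definition monomial (u : C) (q : rat) : rat -> C :=
  fun p => if p == q then u else 0.

(* The smallest common denominator of the exponents. *)
Definition ramification (a : rat -> C) : nat :=
  xget 0%N [set N | common_denominator a N /\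
                    forall M, common_denominator a M -> (N <= M)%N].

(* The value of a(t^N), for [a] without terms of negative order and [N] a
   common denominator of its exponents. *)
Definition puiseux_eval (a : rat -> C) (N : nat) (t : C) : C :=
  limn (series (t_series a N t)).

Definition arc_param (a : rat -> C) (t : C) : C2 :=
  (puiseux_eval a (ramification a) t, t ^+ ramification a).

(* Germ at the origin of a subset of C^2, as an equivalence class of sets. *)
Definition set_germ (A : set C2) : set (set C2) :=
  [set B | \forall p \near (0 : C2), A p <-> B p].

(* The curve germ a_* . The points of [range (arc_param a)] close to 0 have
   parameter t close to 0, since t^N is their second coordinate. *)
Definition curve_germ (a : rat -> C) : set (set C2) :=
  set_germ (range (arc_param a)).

(* The order in y of h(a(y), y): as y = t^N, it is k / N when h(a(t^N), t^N) is
   equivalent to a nonzero multiple of |t|^k; it is +oo if there is no such k.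
   It is applied only to the nonnegative function h = ||grad f||. *)
Definition ord_along (h : C2 -> C) (a : rat -> C) : \bar rat :=
  xget +oo%E [set (k%:R / (ramification a)%:R)%:E | k in
    [set k : nat | exists2 c : C, c != 0 &
       (fun t : C => h (arc_param a t) / `|t| ^+ k : C) @ (0 : C)^' --> c]].

End Arcs.

Section Canyons.
Variable R : realType.
Local Notation C := (Cplx R).
Local Notation C2 := (Cplx R * Cplx R)%type.
Implicit Types (f : C2 -> C) (a g : rat -> C).

Definition vanishes_along (h : C2 -> C) a : Prop :=
  \forall t \near (0 : C), h (arc_param a t) = 0.

Definition polar_arc f g : Prop :=
  [/\ puiseux1 g, vanishes_along (partial_x f) g & ~ vanishes_along f g].

(* "For generic u" means for all but finitely many u; q > 0 is required for
   f(g(y) + u y^q, y) to make sense for the germ f. *)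
Definition grad_order_stable f g (q : rat) : Prop :=
  0 < q /\
  finite_set [set u : C | ord_along (grad_norm f) (g \+ monomial u q)
                          <> ord_along (grad_norm f) g].

Definition gradient_degree f g (d : rat) : Prop :=
  grad_order_stable f g d /\ forall q, grad_order_stable f g q -> d <= q.

(* The set of the curve germs a_* with a = g + u y^d + h.o.t. *)
Definition canyon_of g (d : rat) : set (set (set C2)) :=
  [set curve_germ a | a in
    [set a | puiseux1 a /\
       exists u : C, (d%:E < ord (a \- (g \+ monomial u d))%R)%E]].

Definition gradient_canyon f (K : set (set (set C2))) (d : rat) : Prop :=
  exists g, [/\ polar_arc f g, gradient_degree f g d & K = canyon_of g d].

(* f_x = v \prod_i (x - gamma_i(y)) with v a unit, written after the
   substitution y = t^N for a common denominator N of the gamma_i. *)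
Definition polar_factorization f (n : nat) (gamma : 'I_n -> rat -> C) : Prop :=
  (forall i, puiseux1 (gamma i)) /\
  exists (v : C2 -> C) (N : nat),
    [/\ holomorphic_germ v, v 0 != 0,
        forall i, common_denominator (gamma i) N &
        \forall p \near (0 : C2),
          partial_x f (p.1, p.2 ^+ N) =
          v (p.1, p.2 ^+ N) *
            \prod_(i < n) (p.1 - puiseux_eval (gamma i) N p.2)].

Section Multiplicities.
Variables (n : nat) (gamma : 'I_n -> rat -> C).
Variables (K : set (set (set C2))) (d : rat).

Definition canyon_index : {set 'I_n} :=
  finset (fun i => `[< K (curve_germ (gamma i)) >]).

Definition same_trunk : rel 'I_n :=
  fun i j => (d%:E <= ord (gamma i \- gamma j)%R)%E.

Definition canyon_mult : nat := #|canyon_index|.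

(* The bar multiplicity computed from the representative gamma_j. *)
Definition canyon_bar_mult (j : 'I_n) : nat :=
  #|finset (fun i => (i \in canyon_index) && same_trunk i j)|.

Definition trunk_number : nat :=
  #|equivalence_partition same_trunk canyon_index|.

End Multiplicities.

End Canyons.

(* Main.v *)
(* If two arcs define the same curve germ, the identity theorem, together with
   the finiteness of the group of N-th roots of unity, shows that they are
   conjugate under y^(1/N) -> xi y^(1/N).  Hence any two arcs of a canyon agree,
   below order d, up to conjugation.  As f_x(x, t^N) does not change when t is
   replaced by xi t, conjugation permutes the roots of f_x, and it preserves
   curve germs.  It therefore maps each trunk of the canyon injectively into any
   other one, so all trunks have the same cardinality. *)

Require Import Defs.
From mathcomp Require Import all_boot all_order all_fingroup all_algebra.
From mathcomp Require Import complex.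
From mathcomp Require Import all_classical all_reals all_analysis.

Set Implicit Arguments.
Unset Strict Implicit.
Unset Printing Implicit Defensive.

Import Order.TTheory GRing.Theory Num.Theory.
Import numFieldNormedType.Exports.

Local Open Scope ring_scope.

(** * Convergent power series and the identity theorem *)

Section PowerSeries.
Local Open Scope classical_set_scope.
Variable F : numFieldType.
Local Notation C := (F^o).
Implicit Types (c : nat -> C) (t w xi : C).

Definition pterm c t : nat -> C := fun n => c n * t ^+ n.
Definition psum c t : C := limn (series (pterm c t)).
Definition pcvg c : Prop :=
  \forall t \near (0 : C), cvgn (series (pterm c t)).

(** The terms of a series converging at a nonzero point tend to 0 there, hence are bounded. *)
Lemma pcvg_coef_bound c : pcvg c ->
  exists rho B : C, [/\ 0 < rho, 0 < B & forall k, `|c k| * rho ^+ k <= B].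
Proof.
move=> /nbhs_norm0P[r /= r0 cv].
have r2 : 0 < r / 2 by rewrite divr_gt0.
have h : `|r / 2| < r by rewrite gtr0_norm // ltr_pdivrMr // ltr_pMr // ltr1n.
have cv2 : cvgn (pterm c (r / 2)).
  by apply/cvg_ex; eexists; exact: (cvg_series_cvg_0 (cv _ h)).
have [M [Mreal MP]] := cvg_seq_bounded cv2.
exists (r / 2), (`|M| + 1); split; [exact: r2|exact: ltr_wpDl|].
move=> k; have /= := MP (`|M| + 1) _ k Logic.I.
rewrite /pterm normrM normrX (gtr0_norm r2); apply.
by rewrite (le_lt_trans (real_ler_norm Mreal)) // ltrDl.
Qed.

(** Comparison with a geometric series, whose ratio [|t| / rho] is at most 1/2. *)
Lemma series_tail_le c (rho B : C) K n t : 0 < rho -> 0 < B ->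
  (forall k, `|c k| * rho ^+ k <= B) -> `|t| <= rho / 2 -> (K <= n)%N ->
  `|series (pterm c t) n - series (pterm c t) K| <= 2 * B * (`|t| / rho) ^+ K.
Proof.
move=> rho0 B0 cB tle Kn; rewrite sub_series_geq //.
set x := `|t| / rho.
have x0 : 0 <= x by rewrite divr_ge0 // ltW.
have x2 : x <= 2^-1 by rewrite ler_pdivrMr // mulrC.
rewrite -(subnKC Kn); set m := (n - K)%N.
(* The last factor is the partial sum of [2^-k] for [k < m]; keeping it exact makes the induction on
   [m] go through. *)
suff : `|\sum_(K <= k < K + m) pterm c t k| <=
       B * x ^+ K * (2 - 2 * 2^-1 ^+ m).
  move/le_trans; apply; rewrite [2 * B]mulrC -[leRHS]mulrA [2 * x ^+ K]mulrC mulrA.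
  rewrite ler_wpM2l //; first by rewrite mulr_ge0 ?exprn_ge0 // ltW.
  by rewrite gerBl mulr_ge0 ?exprn_ge0.
elim: m => [|m IH].
  by rewrite addn0 big_geq // normr0 expr0 mulr1 subrr mulr0.
rewrite addnS big_nat_recr ?leq_addr //=.
apply: (le_trans (ler_normD _ _)).
have step : `|pterm c t (K + m)| <= B * x ^+ K * 2^-1 ^+ m.
  rewrite /pterm normrM normrX.
  have -> : `|t| = rho * x by rewrite mulrC divfK // gt_eqF.
  rewrite exprMn mulrA [x ^+ (K + m)%N]exprD mulrA.
  apply: ler_pM => //.
  - by rewrite !mulr_ge0 ?exprn_ge0 // ltW.
  - by rewrite exprn_ge0.
  - by rewrite ler_wpM2r ?exprn_ge0.
  - by rewrite lerXn2r // nnegrE.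
apply: (le_trans (lerD IH step)).
rewrite -mulrDr ler_wpM2l //; first by rewrite mulr_ge0 ?exprn_ge0 // ltW.
rewrite exprS mulrA divff ?pnatr_eq0 // mul1r -addrA lerD2l.
by rewrite mulr_natl mulr2n opprD addrNK.
Qed.

Lemma psum_tail c K : pcvg c -> exists2 D : C, 0 < D &
  \forall t \near (0 : C)^',
    `|psum c t - series (pterm c t) K| <= D * `|t| ^+ K.
Proof.
move=> cv; have [rho [B [rho0 B0 cB]]] := pcvg_coef_bound cv.
(* Two units of [B * (|t| / rho) ^ K] bound the tail of a partial sum; a third bounds the distance
   from that partial sum to the limit. *)
exists (3 * B / rho ^+ K); first by rewrite divr_gt0 ?exprn_gt0 // mulr_gt0.
near=> t.
have tle : `|t| <= rho / 2 by near: t; apply: dnbhs0_le; rewrite divr_gt0.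
have t0 : t != 0 by near: t; exact: nbhs_dnbhs_neq.
have cvt : cvgn (series (pterm c t)) by near: t; exact: cvg_within.
have e0 : 0 < B * (`|t| / rho) ^+ K.
  by rewrite mulr_gt0 // exprn_gt0 // divr_gt0 // normr_gt0.
have /cvgrPdist_le/(_ _ e0) lim_near : series (pterm c t) @ \oo --> psum c t by [].
near \oo => n.
have n1 : `|psum c t - series (pterm c t) n| <= B * (`|t| / rho) ^+ K by near: n.
have Kn : (K <= n)%N by near: n; exists K.
have -> : psum c t - series (pterm c t) K =
  (psum c t - series (pterm c t) n) + (series (pterm c t) n - series (pterm c t) K).
  by rewrite addrA subrK.
apply: (le_trans (ler_normD _ _)).
apply: (le_trans (lerD n1 (series_tail_le rho0 B0 cB tle Kn))).
set X := B * _; rewrite -mulrA -/X -[X in X + _]mul1r -mulrDl.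
by rewrite nat1r /X expr_div_n -!mulrA [_^-1 * _]mulrC.
Unshelve. all: by end_near. Qed.

(** The first nonzero term [c k * t ^ k] dominates the remainder, which is of size [|t| ^ k.+1]. *)
Lemma psum_neq0 c : pcvg c -> (exists k, c k != 0) ->
  \forall t \near (0 : C)^', psum c t != 0.
Proof.
move=> cv exk; have [k ck kmin] := ex_minnP exk.
have [D D0 tail] := psum_tail k.+1 cv.
near=> t.
have t0 : t != 0 by near: t; exact: nbhs_dnbhs_neq.
have small : `|t| < `|c k| / D.
  by near: t; apply: dnbhs0_lt; rewrite divr_gt0 // normr_gt0.
have : `|psum c t - series (pterm c t) k.+1| <= D * `|t| ^+ k.+1 by near: t.
apply: contraTneq => ->; rewrite sub0r normrN.
have -> : series (pterm c t) k.+1 = c k * t ^+ k.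
  rewrite /series /= big_nat_recr //= big_nat big1 ?add0r // => i /andP[_ ik].
  rewrite /pterm; have [->|ci] := eqVneq (c i) 0; first by rewrite mul0r.
  by have := kmin i ci; rewrite leqNgt ik.
rewrite normrM normrX exprSr mulrA [_ * `|t|]mulrAC; set x := _ ^+ k.
have x0 : 0 < x by rewrite exprn_gt0 // normr_gt0.
by rewrite ler_pM2r // lt_geF // mulrC -ltr_pdivlMr.
Unshelve. all: by end_near. Qed.

Lemma psumB c c' : pcvg c -> pcvg c' ->
  pcvg (c \- c') /\
  \forall t \near (0 : C), psum (c \- c') t = psum c t - psum c' t.
Proof.
move=> cv cv'.
have eqs t : pterm (c \- c') t = pterm c t \- pterm c' t.
  by apply/funext => n; rewrite /pterm /= mulrBl.
have key t : cvgn (series (pterm c t)) -> cvgn (series (pterm c' t)) ->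
    series (pterm (c \- c') t) @ \oo --> psum c t - psum c' t.
  move=> c1 c2; rewrite eqs.
  rewrite (_ : series _ = fun n => series (pterm c t) n - series (pterm c' t) n).
    exact: cvgB.
  by apply/funext => n; rewrite /series /= sumrB.
split; near=> t.
  apply/cvg_ex; exists (psum c t - psum c' t); apply: key; by near: t.
apply/cvg_lim => //; apply: key; by near: t.
Unshelve. all: by end_near. Qed.

(** Identity theorem: agreement is assumed only at nonzero points accumulating at 0. *)
Lemma psum_inj c c' : pcvg c -> pcvg c' ->
  ~ (\forall t \near (0 : C)^', psum c t != psum c' t) -> c =1 c'.
Proof.
move=> cv cv' often k; apply/eqP/negPn/negP => ck; apply: often.
have [cvB eqB] := psumB cv cv'.
have nz : \forall t \near (0 : C)^', psum (c \- c') t != 0.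
  by apply: psum_neq0 => //; exists k; rewrite /= subr_eq0.
near=> t; rewrite -subr_eq0.
have <- : psum (c \- c') t = psum c t - psum c' t by near: t; exact: cvg_within.
by near: t.
Unshelve. all: by end_near. Qed.

Lemma psum_scale c xi t : psum (fun n => c n * xi ^+ n) t = psum c (xi * t).
Proof.
rewrite /psum; congr (limn (series _)); apply/funext => n.
by rewrite /pterm exprMn mulrA.
Qed.

Lemma pcvg_scale c xi : `|xi| = 1 -> pcvg c -> pcvg (fun n => c n * xi ^+ n).
Proof.
move=> xi1 /nbhs_norm0P[r r0 cv]; apply/nbhs_norm0P; exists r => // t /= tr.
rewrite (_ : pterm _ t = pterm c (xi * t)); last first.
  by apply/funext => n; rewrite /pterm exprMn mulrA.
by apply: cv; rewrite /= normrM xi1 mul1r.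
Qed.

(** Coefficients of the series obtained by substituting [t ^ e] for the variable. *)
Definition spread (e : nat) c : nat -> C :=
  fun n => if (e %| n)%N then c (n %/ e)%N else 0.

(** The multiples of [e] below [n] number [n / e] rounded up, that is [(n + e.-1) %/ e]. *)
Lemma series_spread e c t n : (0 < e)%N ->
  series (pterm (spread e c) t) n = series (pterm c (t ^+ e)) ((n + e.-1) %/ e)%N.
Proof.
move=> e0; elim: n => [|n IH].
  by rewrite add0n divn_small ?prednK // /series /= !big_geq.
rewrite seriesSr IH [pterm (spread e c) t n]/pterm /spread addSnnS prednK //.
rewrite (divnDr _ (dvdnn e)) divnn e0 addn1.
have [/dvdnP[q ->]|endvd] := boolP (e %| n)%N.
  rewrite mulnK // divnMDl // (divn_small (m := e.-1)) ?prednK // addn0.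
  by rewrite seriesSr /pterm -exprM mulnC.
rewrite mul0r addr0 [n in LHS](divn_eq n e).
have r0 : (0 < n %% e)%N by rewrite lt0n -/(dvdn e n).
rewrite -addnA divnMDl // -{1}(prednK r0) addSnnS prednK // (divnDr _ (dvdnn e)) divnn e0.
rewrite (@divn_small (n %% e).-1) ?addn0 ?addn1 //.
by rewrite (leq_ltn_trans (leq_pred _)) // ltn_mod.
Qed.

Lemma psum_spread e c : (0 < e)%N -> pcvg c ->
  pcvg (spread e c) /\
  \forall t \near (0 : C), psum (spread e c) t = psum c (t ^+ e).
Proof.
move=> e0 cv.
have cve : \forall t \near (0 : C), cvgn (series (pterm c (t ^+ e))).
  move: cv => /nbhs_norm0P[r /= r0 cv].
  have r1 : 0 < 1 + r by rewrite addr_gt0.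
  (* This radius is below both 1 and [r], so that [|t| ^ e <= |t| < r]. *)
  apply/nbhs_norm0P; exists (r / (1 + r)); first by rewrite /= divr_gt0.
  move=> t /= tr; apply: cv; rewrite /= normrX.
  have t1 : `|t| <= 1.
    by rewrite (le_trans (ltW tr)) // ler_pdivrMr // mul1r lerDr.
  rewrite (le_lt_trans (ler_iXnr e0 _ t1)) // (lt_le_trans tr) //.
  by rewrite ler_pdivrMr // mulrDr mulr1 lerDl mulr_ge0 // ltW.
have key t : cvgn (series (pterm c (t ^+ e))) ->
    series (pterm (spread e c) t) @ \oo --> psum c (t ^+ e).
  move=> ct; rewrite (_ : series _ =
    series (pterm c (t ^+ e)) \o (fun n => (n + e.-1) %/ e)%N); last first.
    by apply/funext => n; rewrite series_spread.
  apply: cvg_comp ct; apply: (@cvg_comp _ _ _ (addn^~ e.-1) (divn^~ e)).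
    exact: cvg_addnr.
  exact: cvg_divnr.
split; near=> t.
  by apply/cvg_ex; exists (psum c (t ^+ e)); apply: key; near: t.
by apply/cvg_lim => //; apply: key; near: t.
Unshelve. all: by end_near. Qed.

Lemma psum_cvg0 c : pcvg c -> psum c t @[t --> (0 : C)^'] --> c 0%N.
Proof.
move=> cv; have [D D0 tail] := psum_tail 1 cv.
apply/cvgrPdist_lt => e e0; near=> t.
have small : `|t| < e / D by near: t; apply: dnbhs0_lt; rewrite divr_gt0.
rewrite distrC; apply: (@le_lt_trans _ _ (D * `|t|)); last first.
  by rewrite mulrC -ltr_pdivlMr.
have : `|psum c t - series (pterm c t) 1| <= D * `|t| ^+ 1 by near: t.
by rewrite expr1 /series /= big_nat1 /pterm expr0 mulr1.
Unshelve. all: by end_near. Qed.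

(** Makes a choice of [i] that depends on [t] uniform. If every [i] failed for some [j], the
    identity theorem would make it fail on a whole punctured neighbourhood; as [I] is finite, these
    neighbourhoods meet. *)
Lemma psum_pigeonhole (I J : finType) (c : J -> nat -> C)
    (c' : I -> J -> nat -> C) :
  (forall j, pcvg (c j)) -> (forall i j, pcvg (c' i j)) ->
  (\forall t \near (0 : C)^',
     exists i, forall j, psum (c j) t = psum (c' i j) t) ->
  exists i, forall j, c j =1 c' i j.
Proof.
move=> cv cv' eq_near; apply: contrapT => no_i.
have neq_near : \forall t \near (0 : C)^',
    forall i, ~ forall j, psum (c j) t = psum (c' i j) t.
  apply: filter_forall => i.
  have [j neqj] : exists j, ~ c j =1 c' i j.
    apply: contrapT => no_j; apply: no_i; exists i => j.
    by apply: contrapT => neqj; apply: no_j; exists j.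
  have : \forall t \near (0 : C)^', psum (c j) t != psum (c' i j) t.
    apply: contrapT => often; apply: neqj.
    exact: (psum_inj (cv j) (cv' i j) often).
  by apply: filterS => t /eqP neq eqj; apply: neq.
have : \forall t \near (0 : C)^', False.
  near=> t.
  have [i eqi] : exists i, forall j, psum (c j) t = psum (c' i j) t by near: t.
  have neq : forall i, ~ forall j, psum (c j) t = psum (c' i j) t by near: t.
  exact: (neq i eqi).
by move=> /filter_ex[].
Unshelve. all: by end_near. Qed.

End PowerSeries.

(** * Descent of convergence along [t ^ e], and roots of split polynomials *)

Section ClosedField.
Local Open Scope classical_set_scope.
Variable F : numClosedFieldType.
Local Notation C := (F^o).

(** Over a closed field every [s] is some [w ^ e], and the partial sums of [c] at [s] form a
    subsequence of those of [spread e c] at [w]. *)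
Lemma pcvg_spread e (c : nat -> C) : (0 < e)%N -> pcvg (spread e c) -> pcvg c.
Proof.
move=> e0 /nbhs_norm0P[r /= r0 cv].
apply/nbhs_norm0P; exists (r ^+ e); first by rewrite /= exprn_gt0.
move=> s /= sr; pose w : C := e.-root s.
have ws : w ^+ e = s by rewrite /w rootCK.
have wr : `|w| < r.
  by rewrite -(@ltr_pXn2r _ e) ?nnegrE // ?ltW // -normrX ws.
have -> : series (pterm c s) = series (pterm (spread e c) w) \o muln^~ e.
  apply/funext => n /=; rewrite series_spread // ws divnMDl // divn_small ?addn0 //.
  by rewrite prednK.
apply/cvg_ex; exists (psum (spread e c) w).
have cw := cv w wr; apply: cvg_comp cw; exact: cvg_mulnr.
Qed.

End ClosedField.

Lemma prod_sub_perm (F : numFieldType) n (u v : 'I_n -> F) (r : F) : 0 < r ->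
  (forall x, `|x| < r -> \prod_i (x - u i) = \prod_i (x - v i)) ->
  exists s : 'S_n, forall i, u i = v (s i).
Proof.
move=> r0 eq_prod.
pose P (w : 'I_n -> F) := \prod_i ('X - (w i)%:P).
have hornerP w x : (P w).[x] = \prod_i (x - w i).
  by rewrite horner_prod; apply: eq_bigr => i _; rewrite hornerXsubC.
have eqP : P u = P v.
  apply/eqP; rewrite -subr_eq0; apply/negPn/negP => neq0.
  (* Distinct points of the disc, too many to be roots of a nonzero [P u - P v]; the shift by 2
     keeps them strictly inside. *)
  pose rs := [seq r / k.+2%:R | k <- iota 0 (size (P u - P v))].
  have := max_poly_roots neq0 (rs := rs).
  rewrite size_map size_iota ltnn => /(_ _ _)/notF; apply.
    apply/allP => _ /mapP[k _ ->]; rewrite rootE hornerD hornerN !hornerP.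
    rewrite eq_prod ?subrr // gtr0_norm ?divr_gt0 // ltr_pdivrMr //.
    by rewrite ltr_pMr // ltr1n.
  rewrite map_inj_uniq ?iota_uniq // => k l /(mulfI (lt0r_neq0 r0))/invr_inj.
  by move=> /eqP; rewrite eqr_nat => /eqP[].
have := @prod_XsubC_eq F (mktuple u) (mktuple v).
rewrite !big_image => /(_ eqP) /tuple_permP[s es].
exists s => i; have := congr1 (fun t => nth (u i) t i) es.
by rewrite -!tnth_nth !tnth_mktuple.
Qed.

(** * Denominators and orders of Puiseux series *)

Section Puiseux.
Local Open Scope classical_set_scope.
Variable R : realType.
Local Notation C := (Cplx R).
Implicit Types (a b h : rat -> C) (N M e : nat).

Lemma common_denominator_natP a N q : common_denominator a N -> 0 <= q ->
  a q != 0 -> exists k : nat, q = k%:R / N%:R.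
Proof.
move=> [N0 aN] q0 /aN /intrP[z qz].
have N0' : 0 < N%:R :> rat by rewrite ltr0n.
have : 0 <= q * N%:R by rewrite mulr_ge0 // ltW.
rewrite qz ler0z; case: z qz => // k qk _; exists k.
by rewrite -pmulrn in qk; rewrite -qk mulfK // gt_eqF.
Qed.

Lemma common_denominatorM a N e : common_denominator a N -> (0 < e)%N ->
  common_denominator a (N * e).
Proof.
move=> [N0 aN] e0; split; first by rewrite muln_gt0 N0.
by move=> q /aN qN; rewrite natrM mulrA; apply: rpredM => //; exact: rpred_nat.
Qed.

Lemma common_denominator_gcd a N M : common_denominator a N ->
  common_denominator a M -> common_denominator a (gcdn N M).
Proof.
move=> [N0 aN] [M0 aM]; split; first by rewrite gcdn_gt0 N0.
move=> q aq; have := aN q aq; have := aM q aq.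
case: (egcdnP M N0) => u v def_gcd _ qM qN.
have -> : q * (gcdn N M)%:R = u%:R * (q * N%:R) - v%:R * (q * M%:R).
  by rewrite !(mulrCA _ q) -mulrBr -!natrM def_gcd natrD addrAC subrr add0r.
by apply: rpredB; apply: rpredM => //; exact: rpred_nat.
Qed.

(** Common denominators are closed under gcd, so the least one divides all others. The existence of
    [N] rules out the default value 0. *)
Lemma ramificationP a N : common_denominator a N ->
  common_denominator a (ramification a) /\ (ramification a %| N)%N.
Proof.
move=> cdN; have exN : exists M, `[< common_denominator a M >].
  by exists N; apply/asboolP.
have [n /asboolP cdn nmin] := ex_minnP exN.
have : common_denominator a (ramification a) /\
    forall M, common_denominator a M -> (ramification a <= M)%N.
  rewrite /ramification; case: xgetP => [x _ //|/(_ n)[]].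
  by split=> // M /asboolP/nmin.
move=> [cdr rmin]; split=> //.
have cdg := common_denominator_gcd cdr cdN.
have := dvdn_leq (proj1 cdr) (dvdn_gcdl (ramification a) N).
move=> gle; have := dvdn_gcdr (ramification a) N.
suff -> : gcdn (ramification a) N = ramification a by [].
by apply/eqP; rewrite eqn_leq gle rmin.
Qed.

Lemma min_support h N (q0 p : rat) : common_denominator h N ->
  (forall q, q < q0 -> h q = 0) -> h p != 0 ->
  exists q, h q != 0 /\ forall q', q' < q -> h q' = 0.
Proof.
move=> [N0 hN] hq0 hp.
have N0' : 0 < N%:R :> rat by rewrite ltr0n.
(* Shifting by an integer above [|q0|] and scaling by [N] sends the support into the naturals, where
   a minimum exists. *)
pose B := Num.bound `|q0|.
have lbB q : h q != 0 -> 0 <= q + B%:R.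
  move=> hq; have : q0 <= q by rewrite leNgt; apply: contra_neqN hq => /hq0.
  rewrite -(lerD2r B%:R); apply: le_trans.
  rewrite -[q0]opprK addrC subr_ge0 (le_trans (ler_norm _)) // normrN ltW //.
  exact: archi_boundP.
have key q : h q != 0 -> exists k : nat, q = k%:R / N%:R - B%:R.
  move=> hq; have /intrP[z qz] : (q + B%:R) * N%:R \is a Num.int.
    rewrite mulrDl; apply: rpredD; first exact: hN.
    by rewrite -natrM rpred_nat.
  have : 0 <= (q + B%:R) * N%:R by rewrite mulr_ge0 ?lbB // ltW.
  rewrite qz ler0z; case: z qz => // k qk _; exists k.
  by rewrite -pmulrn in qk; rewrite -qk mulfK ?gt_eqF // addrK.
have [k0 pk0] := key p hp.
have exk : exists k : nat, h (k%:R / N%:R - B%:R) != 0.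
  by exists k0; rewrite -pk0.
have [k hk kmin] := ex_minnP exk.
exists (k%:R / N%:R - B%:R); split=> // q' lt_q'.
apply/eqP/negPn/negP => hq'; have [k' q'k'] := key q' hq'.
move: lt_q' hq'; rewrite q'k' ltrD2r ltr_pM2r ?invr_gt0 // ltr_nat => lt_k' /kmin.
by rewrite leqNgt lt_k'.
Qed.

Lemma ord_minE h q : h q != 0 -> (forall q', q' < q -> h q' = 0) ->
  ord h = q%:E.
Proof.
move=> hq qmin; rewrite /ord; case: xgetP => [_ _ [p [hp pmin] <-]|/(_ q%:E)[]].
  congr EFin; apply/eqP; rewrite eq_le !leNgt; apply/andP; split; apply/negP.
    by move=> /pmin /eqP; rewrite (negbTE hq).
  by move=> /qmin /eqP; rewrite (negbTE hp).
by exists q.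
Qed.

Lemma lee_ord h N (q0 x : rat) : common_denominator h N ->
  (forall q, q < q0 -> h q = 0) ->
  (x%:E <= ord h)%E <-> forall q, q < x -> h q = 0.
Proof.
move=> cdh hq0; split=> [xle q qx|hx].
  apply/eqP/negPn/negP => hq.
  have [p [hp pmin]] := min_support cdh hq0 hq.
  move: xle; rewrite (ord_minE hp pmin) lee_fin => xp.
  by have := pmin q (lt_le_trans qx xp); apply/eqP.
(* If the support has no least exponent, [ord] takes its default [+oo] and the bound is trivial. *)
rewrite /ord; case: xgetP => [_ _ [p [hp _] <-]|_]; last by rewrite leey.
by rewrite lee_fin leNgt; apply: contra_neqN hp => /hx.
Qed.

Lemma lte_ord_coef0 h N (q0 x : rat) : common_denominator h N ->
  (forall q, q < q0 -> h q = 0) -> (x%:E < ord h)%E ->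
  forall q, q <= x -> h q = 0.
Proof.
move=> cdh hq0 xlt q qx; apply/eqP/negPn/negP => hq.
have [p [hp pmin]] := min_support cdh hq0 hq.
move: xlt; rewrite (ord_minE hp pmin) lte_fin => xp.
by have := pmin q (le_lt_trans qx xp); apply/eqP.
Qed.

(** * Substitution [y = t ^ N] for an arbitrary common denominator *)

Definition coefs a N : nat -> C := fun n => a (n%:R / N%:R).

Lemma puiseux_evalE a N : puiseux_eval a N = psum (coefs a N).
Proof. by []. Qed.

Lemma coefs_spread a N e : common_denominator a N -> (0 < e)%N ->
  coefs a (N * e) = spread e (coefs a N).
Proof.
move=> [N0 aN] e0; apply/funext => k; rewrite /coefs /spread.
have N0' : N%:R != 0 :> rat by rewrite pnatr_eq0 -lt0n.
have e0' : e%:R != 0 :> rat by rewrite pnatr_eq0 -lt0n.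
have [/dvdnP[j ->]|endvd] := boolP (e %| k)%N.
  by rewrite mulnK // !natrM -mulf_div divff // mulr1.
apply/eqP/negPn/negP => /aN /intrP[z kz]; move/negP: endvd; apply.
have kz' : k%:R = z%:~R * e%:R :> rat.
  by rewrite -kz -mulrA -natrM divfK // natrM mulf_neq0.
have {}kz' : k%:Z = z * e%:Z by apply: (@intr_inj rat); rewrite rmorphM.
by have : (e%:Z %| k%:Z)%Z by apply/dvdzP; exists z.
Qed.

(** The definition gives convergence for one denominator [M] only: pass up to the common multiple
    [N * M], then down to [N]. *)
Lemma pcvg_coefs a N : puiseux a -> common_denominator a N ->
  pcvg (coefs a N).
Proof.
move=> [M [cdM _ [r r0 cv]]] cdN.
have [[M0 _] [N0 _]] := (cdM, cdN).
have cvM : pcvg (coefs a M) by apply/nbhs_norm0P; exists r.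
have cvMN : pcvg (spread M (coefs a N)).
  have <- : spread N (coefs a M) = spread M (coefs a N).
    by rewrite -coefs_spread // mulnC coefs_spread.
  exact: (psum_spread N0 cvM).1.
exact: (@pcvg_spread (complex R) M _ M0 cvMN).
Qed.

Lemma puiseux_evalM a N e : puiseux a -> common_denominator a N ->
  (0 < e)%N ->
  \forall t \near (0 : C), puiseux_eval a (N * e) t = puiseux_eval a N (t ^+ e).
Proof.
move=> pa cdN e0; rewrite (puiseux_evalE a (N * e)) (coefs_spread cdN e0).
exact: (psum_spread e0 (pcvg_coefs pa cdN)).2.
Qed.

(** * Conjugate series and equality of curve germs *)

Lemma puiseux1_coef0 a q : puiseux1 a -> q < 1 -> a q = 0.
Proof.
move=> [[N [cdN [q0 aq0] _]] +]; rewrite (lee_ord _ cdN aq0); exact.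
Qed.

(** Conjugates have the same support, hence the same ramification [n]. With [N = e * n], their
    parametrizations differ by the rotation [t -> xi ^ e * t], so the ranges coincide. *)
Lemma conj_curve_germ a b N (xi : C) : puiseux1 a -> puiseux1 b ->
  common_denominator a N -> common_denominator b N -> xi ^+ N = 1 ->
  (forall k, coefs b N k = coefs a N k * xi ^+ k) ->
  curve_germ a = curve_germ b.
Proof.
move=> pa pb cda cdb xiN ab.
have xi0 : xi != 0.
  apply: contra_eq_neq xiN => ->; rewrite expr0n gtn_eqF ?(proj1 cda) //.
  by rewrite eq_sym oner_neq0.
have supp q : (b q == 0) = (a q == 0).
  have [q1|q1] := ltP q 1; first by rewrite !(puiseux1_coef0 _ q1).
  have q0 : 0 <= q by rewrite (le_trans _ q1).
  have key k : (b (k%:R / N%:R) == 0) = (a (k%:R / N%:R) == 0).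
    have := ab k; rewrite /coefs => ->.
    by rewrite mulf_eq0 (negbTE (expf_neq0 _ xi0)) orbF.
  have [a0|aq] := eqVneq (a q) 0; have [b0|bq] := eqVneq (b q) 0 => //.
    have [k qk] := common_denominator_natP cdb q0 bq.
    by move: bq; rewrite qk key -qk a0 eqxx.
  have [k qk] := common_denominator_natP cda q0 aq.
  by move: aq; rewrite qk -key -qk b0 eqxx.
have cdE : common_denominator b = common_denominator a.
  apply/funext => M; rewrite /common_denominator; apply/propext.
  by split=> -[M0 h]; split=> // q; [rewrite -supp|rewrite supp]; exact: h.
have ramE : ramification b = ramification a by rewrite /ramification cdE.
have [[n0 _] /dvdnP[e Ne]] := ramificationP cda.
move: ramE n0 Ne; rewrite /curve_germ /arc_param => ->; set n := ramification a => n0 Ne.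
have e0 : (0 < e)%N.
  by have := cda.1; rewrite Ne muln_gt0 => /andP[].
have coef_n (c : rat -> C) k : coefs c N (k * e) = coefs c n k.
  rewrite /coefs Ne mulnC !natrM -mulf_div divff ?mul1r //.
  by rewrite pnatr_eq0 -lt0n.
have evalE t : puiseux_eval b n t = puiseux_eval a n (xi ^+ e * t).
  rewrite !puiseux_evalE -psum_scale; congr psum; apply/funext => k.
  by rewrite -!coef_n ab -exprM mulnC.
have omegan : (xi ^+ e) ^+ n = 1 by rewrite -exprM -Ne.
congr set_germ; apply/seteqP; split=> _ /= [t _ <-].
  exists ((xi ^+ e)^-1 * t) => //; rewrite evalE mulrA divff ?expf_neq0 // mul1r.
  by rewrite exprMn exprVn omegan invr1 mul1r.
by exists (xi ^+ e * t) => //; rewrite evalE exprMn omegan mul1r.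
Qed.

Lemma near_prod (P : C * C -> Prop) : (\forall p \near (0 : C * C), P p) ->
  exists2 r : C, 0 < r & forall x y, `|x| < r -> `|y| < r -> P (x, y).
Proof.
move=> /nbhs_ballP[r /= r0 rP]; exists r => // x y xr yr.
by apply: rP; split; rewrite /= -ball_normE /ball_ /= sub0r normrN.
Qed.

(** The rotation is quantified inside the neighbourhood because in [eq_germ_conj] it depends on the
    point. *)
Lemma near_rotate (P : C -> Prop) : (\forall t \near (0 : C), P t) ->
  \forall t \near (0 : C), forall xi : C, `|xi| = 1 -> P (xi * t).
Proof.
move=> /nbhs_norm0P[r r0 rP]; apply/nbhs_norm0P; exists r => // t /= tr xi xi1.
by apply: rP; rewrite /= normrM xi1 mul1r.
Qed.

Lemma norm_unity_root (xi : C) N : (0 < N)%N -> xi ^+ N = 1 -> `|xi| = 1.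
Proof.
move=> N0 xiN; apply/eqP.
by rewrite -(@pexpr_eq1 _ _ N) // -normrX xiN normr1.
Qed.

Lemma cvg_expr0 N : (0 < N)%N ->
  (fun t : C => t ^+ N : C) t @[t --> (0 : C)^'] --> (0 : C).
Proof.
move=> N0; apply/cvgr0Pnorm_lt => eps eps0; near=> t.
have t1 : `|t| <= 1 by near: t; apply: dnbhs0_le.
rewrite normrX (le_lt_trans (ler_iXnr N0 _ t1)) //.
by near: t; apply: dnbhs0_lt.
Unshelve. all: by end_near. Qed.

(** Each small [w] yields a root of unity [xi] matching the two series at [w]; the pigeonhole lemma
    then fixes one [xi] for all coefficients. *)
Lemma eq_germ_conj a b N : puiseux1 a -> puiseux1 b ->
  common_denominator a N -> common_denominator b N ->
  curve_germ a = curve_germ b ->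
  exists2 xi : C, xi ^+ N = 1 &
    forall k, coefs a N k = coefs b N k * xi ^+ k.
Proof.
move=> pa pb cda cdb eq_germ.
have N0 := cda.1.
have [[n0 _] /dvdnP[e Ne]] := ramificationP cda.
have [[m0 _] /dvdnP[e' Ne']] := ramificationP cdb.
have e0 : (0 < e)%N by move: N0; rewrite Ne muln_gt0 => /andP[].
have e'0 : (0 < e')%N by move: N0; rewrite Ne' muln_gt0 => /andP[].
have cvA := pcvg_coefs pa.1 cda; have cvB := pcvg_coefs pb.1 cdb.
have near_eq : \forall w \near (0 : C)^',
    exists2 xi : C, xi ^+ N = 1 & psum (coefs a N) w = psum (coefs b N) (xi * w).
  have germ_b : \forall p \near (0 : C * C),
      range (arc_param b) p <-> range (arc_param a) p.
    suff : curve_germ b (range (arc_param a)) by [].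
    by rewrite -eq_germ /curve_germ /set_germ /=; near=> p.
  have [r r0 near_b] := near_prod germ_b.
  have psum_to0 : psum (coefs a N) w @[w --> (0 : C)^'] --> (0 : C).
    have := psum_cvg0 cvA; rewrite {2}/coefs mul0r.
    by rewrite (puiseux1_coef0 pa) // ltr01.
  have evA := puiseux_evalM pa.1 (ramificationP cda).1 e0.
  have evB := near_rotate (puiseux_evalM pb.1 (ramificationP cdb).1 e'0).
  near=> w.
  have w0 : w != 0 by near: w; exact: nbhs_dnbhs_neq.
  have arc_a : range (arc_param a) (psum (coefs a N) w, w ^+ N).
    have wE : (w ^+ e) ^+ ramification a = w ^+ N by rewrite -exprM -Ne.
    have evE : puiseux_eval a (ramification a) (w ^+ e) = psum (coefs a N) w.
      rewrite -puiseux_evalE Ne mulnC; apply/esym.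
      near: w; exact: cvg_within.
    by exists (w ^+ e); [exact: Logic.I|rewrite /arc_param evE wE].
  have [s _ arcE] : range (arc_param b) (psum (coefs a N) w, w ^+ N).
    apply: (near_b _ _ _ _).2 arc_a; near: w; first exact: cvgr0_norm_lt.
    exact: (cvgr0_norm_lt _ (cvg_expr0 N0)).
  have evs : puiseux_eval b (ramification b) s = psum (coefs a N) w.
    exact: (congr1 fst arcE).
  have sm : s ^+ ramification b = w ^+ N := congr1 snd arcE.
  have w'0 : w ^+ e' != 0 by rewrite expf_neq0.
  (* [s] and [w ^ e'] have the same power of exponent [ramification b], so an [e']-th root of their
     quotient is an [N]-th root of unity, and [s = (xi * w) ^ e']. *)
  pose xi : C := e'.-root (s / w ^+ e').
  have xie : xi ^+ e' = s / w ^+ e' by rewrite /xi rootCK.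
  have xiN : xi ^+ N = 1.
    by rewrite Ne' exprM xie expr_div_n sm -exprM -Ne' divff ?expf_neq0.
  exists xi; first exact: xiN.
  rewrite -evs -puiseux_evalE [in RHS]Ne' mulnC.
  have <- : (xi * w) ^+ e' = s by rewrite exprMn xie divfK.
  apply/esym; move: xi xiN {xie} => xi /(norm_unity_root N0); move: xi.
  near: w; exact: cvg_within.
(* Listing the [N]-th roots of unity provides the finite index type for the pigeonhole. *)
have [rs def_rs] := @closed_field_poly_normal (complex R) ('X^N - 1).
have rsP (z : C) : (z \in rs) = (z ^+ N == 1).
  rewrite -subr_eq0.
  have -> : z ^+ N - 1 = ('X^N - 1 : {poly complex R}).[z].
    by rewrite hornerD hornerN hornerXn hornerC.
  rewrite {}def_rs (monicP (monicXnsubC 1 N0)) scale1r.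
  by have := root_prod_XsubC rs z; rewrite /root => ->.
have [|||xi eqxi] := @psum_pigeonhole _ 'I_(size rs) unit (fun=> coefs a N)
  (fun i _ k => coefs b N k * rs`_i ^+ k).
- by move=> _; exact: cvA.
- move=> i _; apply: pcvg_scale cvB; apply: (norm_unity_root N0).
  by apply/eqP; rewrite -rsP mem_nth.
- near=> w.
  have [xi xiN eqw] : exists2 xi : C, xi ^+ N = 1 &
      psum (coefs a N) w = psum (coefs b N) (xi * w) by near: w.
  have xirs : xi \in rs by rewrite rsP xiN.
  exists (Ordinal (etrans (index_mem xi rs) xirs)) => _.
  by rewrite /= nth_index // psum_scale.
exists rs`_xi; first by apply/eqP; rewrite -rsP mem_nth.
exact: (eqxi tt).
Unshelve. all: by end_near. Qed.

(** * Truncation below order [d], canyons and the polar roots *)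

Lemma common_denominator_sub a b h N : common_denominator a N ->
  common_denominator b N -> (forall q, a q = 0 -> b q = 0 -> h q = 0) ->
  common_denominator h N.
Proof.
move=> [N0 aN] [_ bN] hab; split=> // q hq.
have [a0|aq] := eqVneq (a q) 0; last exact: aN.
by have [b0|bq] := eqVneq (b q) 0; [rewrite (hab q a0 b0) eqxx in hq|exact: bN].
Qed.

Lemma puiseux1_common_denominator a : puiseux1 a ->
  exists N, common_denominator a N.
Proof. by move=> [[N [cdN _ _]] _]; exists N. Qed.

Lemma lee_ord_sub a b N d : puiseux1 a -> puiseux1 b ->
  common_denominator a N -> common_denominator b N ->
  (d%:E <= ord (a \- b)%R)%E = `[< forall q, q < d -> a q = b q >].
Proof.
move=> pa pb cda cdb.
have cdh : common_denominator (a \- b) N.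
  by apply: common_denominator_sub cda cdb _ => q /= -> ->; rewrite subrr.
have h0 q : q < 1 -> (a \- b) q = 0.
  by move=> q1; rewrite /= (puiseux1_coef0 pa q1) (puiseux1_coef0 pb q1) subrr.
have iff_ord := lee_ord d cdh h0.
apply/idP/asboolP => [/iff_ord eq0 q /eq0 /eqP|eqd].
  by rewrite /= subr_eq0 => /eqP.
by apply/iff_ord => q /eqd /= ->; rewrite subrr.
Qed.

Lemma lte_ord_canyon a g (u : C) d : puiseux1 a -> puiseux1 g -> 1 < d ->
  (d%:E < ord (a \- (g \+ monomial u d))%R)%E ->
  forall q, q < d -> a q = g q.
Proof.
move=> pa pg d1 dlt q qd.
have [Na cda] := puiseux1_common_denominator pa.
have [Ng cdg] := puiseux1_common_denominator pg.
(* The denominator of [d] serves for the monomial [u y^d]. *)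
pose D := `|denq d|%N.
have D0 : (0 < D)%N by rewrite absz_gt0 denq_neq0.
have cdm : common_denominator (monomial u d) D.
  split=> // p; rewrite /monomial; have [->|] := eqVneq p d; last by rewrite eqxx.
  move=> _; have -> : D%:R = (denq d)%:~R :> rat.
    by rewrite pmulrn /D gez0_abs // denq_ge0.
  by rewrite -numqE intr_int.
have cdh : common_denominator (a \- (g \+ monomial u d)) (Na * Ng * D).
  have Nga : (0 < Na * Ng)%N by rewrite muln_gt0 cda.1 cdg.1.
  apply: (@common_denominator_sub a (g \+ monomial u d)).
  - by rewrite -mulnA; apply: common_denominatorM => //; rewrite muln_gt0 cdg.1.
  - apply: (@common_denominator_sub g (monomial u d)).
    + by rewrite mulnAC mulnC; apply: common_denominatorM => //; rewrite muln_gt0 cda.1.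
    + by rewrite mulnC; apply: common_denominatorM.
    + by move=> p /= -> ->; rewrite addr0.
  - by move=> p /= -> ->; rewrite subr0.
have h0 p : p < 1 -> (a \- (g \+ monomial u d)) p = 0.
  move=> p1; rewrite /= (puiseux1_coef0 pa p1) (puiseux1_coef0 pg p1).
  rewrite /monomial lt_eqF ?addr0 ?subr0 //.
  exact: lt_trans p1 d1.
have := lte_ord_coef0 cdh h0 dlt (ltW qd).
by rewrite /= /monomial lt_eqF // addr0 => /eqP; rewrite subr_eq0 => /eqP.
Qed.

(** Invariance of [f_x(x, t^N)] under [t -> xi t] permutes the root values at each small [t]; the
    pigeonhole over ['S_n] makes the permutation independent of [t]. The guard [0 < N] is for
    [n = 0], where no root certifies that [N] is positive. *)
Lemma polar_conj_perm f n (gamma : 'I_n -> rat -> C) :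
  polar_factorization f gamma ->
  exists N, (forall i, common_denominator (gamma i) N) /\
    ((0 < N)%N -> forall xi : C, xi ^+ N = 1 -> exists s : 'S_n, forall i k,
      coefs (gamma (s i)) N k = coefs (gamma i) N k * xi ^+ k).
Proof.
move=> [pg [v [N [hv v0 cdN fact]]]]; exists N; split=> // N0 xi xiN.
have xi1 := norm_unity_root N0 xiN.
have cvg_gamma i := pcvg_coefs (pg i).1 (cdN i).
have v_neq0 : \forall p \near (0 : C * C), v p != 0.
  have v_cont : v p @[p --> (0 : C * C)] --> v 0.
    exact: (differentiable_continuous (nbhs_singleton hv)).
  exact: cvgr_neq0 v_cont v0.
have [r r0 near_r] := near_prod (filterI fact v_neq0).
have near_perm : \forall t \near (0 : C)^', exists s : 'S_n, forall i,
    psum (fun k => coefs (gamma i) N k * xi ^+ k) t = psum (coefs (gamma (s i)) N) t.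
  near=> t.
  have tr : `|t| < r by near: t; apply: dnbhs0_lt.
  have tNr : `|t ^+ N| < r.
    near: t; exact: (cvgr0_norm_lt _ (cvg_expr0 N0)).
  have [x xr|s eqs] := @prod_sub_perm (complex R) n
      (fun i => puiseux_eval (gamma i) N (xi * t))
      (fun i => puiseux_eval (gamma i) N t) r r0.
    (* The unit [v] takes the same nonzero value at [t] and at [xi * t], so it cancels. *)
    apply: (mulfI (near_r x (t ^+ N) xr tNr).2).
    have xitr : `|xi * t| < r by rewrite normrM xi1 mul1r.
    have eq1 := (near_r x t xr tr).1.
    have eq2 := (near_r x (xi * t) xr xitr).1.
    rewrite /= exprMn xiN mul1r in eq2.
    by rewrite -[LHS]eq2 -[RHS]eq1.
  by exists s => i; rewrite psum_scale -!puiseux_evalE; exact: eqs.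
have [||s eqs] := @psum_pigeonhole _ 'S_n 'I_n
  (fun i k => coefs (gamma i) N k * xi ^+ k)
  (fun s i => coefs (gamma (s i)) N) _ _ near_perm.
- by move=> i; apply: pcvg_scale xi1 (cvg_gamma i).
- by move=> s i; exact: cvg_gamma.
by exists s => i k; rewrite (eqs i k).
Unshelve. all: by end_near. Qed.

Lemma same_trunkE n (gamma : 'I_n -> rat -> C) (d : rat) N i j :
  (forall i, puiseux1 (gamma i)) -> (forall i, common_denominator (gamma i) N) ->
  same_trunk gamma d i j = `[< forall q, q < d -> gamma i q = gamma j q >].
Proof.
by move=> pg cdN; rewrite /same_trunk (lee_ord_sub _ (pg i) (pg j) (cdN i) (cdN j)).
Qed.

(** Membership concerns germs, so [a] and [b] are only conjugate, by [xa] and [xb], to series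
    agreeing with [g] below [d]; the quotient [xa / xb] then relates [b] to [a]. *)
Lemma canyon_conj a b g d N : puiseux1 g -> 1 < d -> puiseux1 a ->
  puiseux1 b -> common_denominator a N -> common_denominator b N ->
  canyon_of g d (curve_germ a) -> canyon_of g d (curve_germ b) ->
  exists2 xi : C, xi ^+ N = 1 & forall k, k%:R / N%:R < d ->
    coefs a N k = coefs b N k * xi ^+ k.
Proof.
move=> pg d1 pa pb cda cdb [a' [pa' [u a'u]] a'a] [b' [pb' [w b'w]] b'b].
have a'g := lte_ord_canyon pa' pg d1 a'u; have b'g := lte_ord_canyon pb' pg d1 b'w.
have [Na cda'] := puiseux1_common_denominator pa'.
have [Nb cdb'] := puiseux1_common_denominator pb'.
have [Na0 Nb0] := (cda'.1, cdb'.1).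
have Nab0 : (0 < Na * Nb)%N by rewrite muln_gt0 Na0.
have [xa xaM a_xa] : exists2 xi : C, xi ^+ (N * (Na * Nb)) = 1 &
    forall k, coefs a (N * (Na * Nb)) k = coefs a' (N * (Na * Nb)) k * xi ^+ k.
  apply: eq_germ_conj => //; first exact: common_denominatorM.
  rewrite mulnCA; apply: common_denominatorM => //; rewrite muln_gt0 Nb0.
  by rewrite cda.1.
have [xb xbM b_xb] : exists2 xi : C, xi ^+ (N * (Na * Nb)) = 1 &
    forall k, coefs b (N * (Na * Nb)) k = coefs b' (N * (Na * Nb)) k * xi ^+ k.
  apply: eq_germ_conj => //; first exact: common_denominatorM.
  rewrite mulnA mulnC; apply: common_denominatorM => //.
  by rewrite muln_gt0 Na0 cda.1.
have N0 := cda.1.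
have M0 : (0 < N * (Na * Nb))%N by rewrite muln_gt0 N0.
have xb0 : xb != 0 by rewrite -normr_gt0 (norm_unity_root M0 xbM) ltr01.
have coefsM (c : rat -> C) k : coefs c N k = coefs c (N * (Na * Nb)) (k * (Na * Nb)).
  rewrite /coefs (natrM _ k) (natrM _ N) -mulf_div divff ?mulr1 //.
  by rewrite pnatr_eq0 -lt0n.
(* Index [k] over [N] is index [k * (Na * Nb)] over the enlarged denominator; this power also
   descends to an [N]-th root of unity. *)
exists ((xa / xb) ^+ (Na * Nb)).
  by rewrite -exprM mulnC expr_div_n xaM xbM divr1.
move=> k kd; rewrite !coefsM a_xa b_xb -!coefsM /coefs a'g // b'g //.
rewrite -exprM [(_ * k)%N]mulnC expr_div_n -mulrA; congr (_ * _).
by rewrite mulrCA divff ?mulr1 // expf_neq0.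
Qed.

(** The conjugation carrying [gamma i] to [gamma j] below [d] permutes the roots by [s], and [s]
    embeds the trunk of [i] into that of [j]. Exchanging [i] and [j] gives equality. *)
Lemma leq_card_trunk f n (gamma : 'I_n -> rat -> C) g d (i j : 'I_n) :
  polar_factorization f gamma -> puiseux1 g -> 1 < d ->
  i \in canyon_index gamma (canyon_of g d) ->
  j \in canyon_index gamma (canyon_of g d) ->
  (canyon_bar_mult gamma (canyon_of g d) d i <=
   canyon_bar_mult gamma (canyon_of g d) d j)%N.
Proof.
move=> fact pg d1 iK jK; have pgam := fact.1.
have [N [cdN conj_perm]] := polar_conj_perm fact.
have N0 := (cdN i).1.
have inK k : (k \in canyon_index gamma (canyon_of g d)) =
    `[< canyon_of g d (curve_germ (gamma k)) >] by rewrite inE.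
move: iK jK; rewrite !inK => /asboolP iK /asboolP jK.
have [xi xiN ji] := canyon_conj pg d1 (pgam j) (pgam i) (cdN j) (cdN i) jK iK.
have [s conj_s] := conj_perm N0 xi xiN.
rewrite /canyon_bar_mult -(card_imset _ (@perm_inj _ s)).
apply/subset_leq_card/fintype.subsetP => _ /imsetP[k + ->].
rewrite !inE !(same_trunkE _ _ _ pgam cdN) => /andP[/asboolP kK /asboolP ki].
apply/andP; split; apply/asboolP.
  by rewrite -(conj_curve_germ (pgam k) (pgam (s k)) (cdN k) (cdN (s k)) xiN (conj_s k)).
move=> q qd; have [q1|q1] := ltP q 1.
  by rewrite (puiseux1_coef0 (pgam (s k)) q1) (puiseux1_coef0 (pgam j) q1).
have q0 : 0 <= q by rewrite (le_trans _ q1).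
have eq_at l : l%:R / N%:R < d ->
    gamma (s k) (l%:R / N%:R) = gamma j (l%:R / N%:R).
  move=> ld; have := conj_s k l; have := ji l ld; rewrite /coefs => -> ->.
  by rewrite ki.
(* [eq_at] covers exponents [l / N] only; at any other [q >= 0] both coefficients vanish. *)
have [sk0|skq] := eqVneq (gamma (s k) q) 0; have [j0|jq] := eqVneq (gamma j q) 0.
- by rewrite sk0 j0.
- have [l ql] := common_denominator_natP (cdN j) q0 jq.
  by rewrite ql eq_at -?ql.
- have [l ql] := common_denominator_natP (cdN (s k)) q0 skq.
  by rewrite ql eq_at -?ql.
- have [l ql] := common_denominator_natP (cdN j) q0 jq.
  by rewrite ql eq_at -?ql.
Qed.

End Puiseux.

(** * Counting the canyon as a partition into trunks of equal size *)

Theorem lemma5p6 (R : realType) (f : Cplx R * Cplx R -> Cplx R) (m : nat)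
    (gamma : 'I_m.-1 -> rat -> Cplx R)
    (K : set (set (set (Cplx R * Cplx R)))) (d : rat) (j : 'I_m.-1) :
  holomorphic_germ f -> f 0 = 0 -> mini_regular_x f m ->
  polar_factorization f gamma ->
  gradient_canyon f K d -> 1 < d ->
  j \in canyon_index gamma K ->
  canyon_mult gamma K =
    (trunk_number gamma K d * canyon_bar_mult gamma K d j)%N.
Proof.
move=> _ _ _ fact [g [[pg _ _] _ ->]] d1 jK.
have [N [cdN _]] := polar_conj_perm fact.
have trunkE i k := same_trunkE d i k fact.1 cdN.
rewrite /canyon_mult /trunk_number; apply: card_uniform_partition; last first.
  apply: equivalence_partitionP => i k l _ _ _; rewrite !trunkE.
  split; first exact/asboolP.
  move=> /asboolP ik; apply/idP/idP => /asboolP h; apply/asboolP => q qd.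
    by rewrite -ik // h.
  by rewrite ik // h.
move=> _ /imsetP[i iK ->].
(* Blocks of the partition use [same_trunk i k], the bar multiplicity [same_trunk k i]; symmetry
   reconciles them. *)
have -> : #|[set k in canyon_index gamma (canyon_of g d) | same_trunk gamma d i k]%SET| =
    canyon_bar_mult gamma (canyon_of g d) d i.
  apply: eq_card => k; rewrite !inE !trunkE; congr (_ && _).
  by apply/asboolP/asboolP => ik q qd; rewrite ik.
by apply/eqP; rewrite eqn_leq !(leq_card_trunk fact pg d1).
Qed.
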